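(* Let $d=1$. For all real $\lambda, r>0$ there exist $t_0>0$ and a constant $c>0$ such that $$\mathbf{P}(T_{\mathrm{isol}}>t)\ge \exp\left(-c\,\sqrt{t}\,\log t\,\log\log t\right)\qquad\text{for all } t\ge t_0.$$
   Context: Let $\Pi_0=\{X_i\}$ be a Poisson point process on $\mathbb{R}^d$ (here $d=1$) of intensity $\lambda>0$ (its points are called nodes). Let $(\xi_i(s))_{s\ge 0}$ be standard Brownian motions in $\mathbb{R}^d$ started at the origin, independent over different $i$ and independent of $\Pi_0$; the position of node $X_i$ at time $s$ is $X_i+\xi_i(s)$. For $r>0$, let $B(x,r)$ be the closed ball of radius $r$ centered at $x$. The isolation time (of a target fixed at the origin) is $$T_{\mathrm{isol}}=\inf\Big\{t\ge 0:\ 0\notin \bigcup_i B(X_i+\xi_i(t),r)\Big\}.$$ *)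

(* Defs.v *)
From HB Require Import structures.
From mathcomp Require Import all_boot all_order all_algebra.
From mathcomp Require Import finmap.
From mathcomp Require Import all_classical all_reals all_analysis measurable_realfun.

Set Implicit Arguments.
Unset Strict Implicit.
Unset Printing Implicit Defensive.

Import Order.TTheory GRing.Theory Num.Theory.
Import numFieldNormedType.Exports.

Local Open Scope classical_set_scope.
Local Open Scope ring_scope.

Definition sigma_of_family {d d'} {Omega : measurableType d}
    {E : measurableType d'} {I : Type} (Y : I -> Omega -> E) (D : set I) :
    set_system Omega :=
  <<s \bigcup_(i in D) preimage_set_system setT (Y i) measurable >>.

Definition mutually_independent {d} {Omega : measurableType d} {R : realType}
    (P : probability Omega R) {I : choiceType} (F : I -> set_system Omega) :
    Prop :=
  forall (J : {fset I}) (A : I -> set Omega), (forall i, F i (A i)) ->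
    P (\bigcap_(i in [set` J]) A i) = (\prod_(i <- J) P (A i))%E.

Definition independent_RVs {d d'} {Omega : measurableType d}
    {E : measurableType d'} {R : realType} (P : probability Omega R)
    {I : choiceType} (Y : I -> Omega -> E) : Prop :=
  mutually_independent P
    (fun i => preimage_set_system setT (Y i) measurable).

Definition point_count {R : realType} {Omega : Type} (X : nat -> Omega -> R)
    (A : set R) (w : Omega) : \bar R :=
  counting [set i | A (X i w)].

(* The points are enumerated by [nat]: a homogeneous Poisson process on the
   whole line has infinitely many points almost surely.  The Poisson weights
   are spelled out because [poisson_pmf 0 k] is 1 for every [k], whereas the
   count of a null set must be 0 almost surely. *)
Record poisson_process {d} {Omega : measurableType d} {R : realType}
    (P : probability Omega R) (lambda : R) (X : nat -> {RV P >-> R}) : Prop := {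
  poisson_count : forall (A : set R) (k : nat), measurable A ->
    (lebesgue_measure A < +oo)%E ->
    let m := lambda * fine (lebesgue_measure A) in
    P [set w | point_count X A w = k%:R%:E]
      = (expR (- m) * m ^+ k / k`!%:R)%:E ;
  poisson_indep : forall A : nat -> set R, (forall n, measurable (A n)) ->
    trivIset setT A ->
    independent_RVs P (fun n => point_count X (A n) : Omega -> \bar R)
}.
Arguments poisson_process {d Omega R} P lambda X.

(* Only times [s >= 0] are constrained.  [normal_prob] takes the standard
   deviation as its second argument, and is not the Dirac mass when the latter
   is 0, whence [s < t]. *)
Record brownian_motion {d} {Omega : measurableType d} {R : realType}
    (P : probability Omega R) (B : R -> {RV P >-> R}) : Prop := {
  brownian_start : {ae P, forall w, B 0 w = 0} ;
  brownian_gauss : forall s t : R, 0 <= s -> s < t ->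
    forall A : set R, measurable A ->
    P [set w | A (B t w - B s w)] = normal_prob 0 (Num.sqrt (t - s)) A ;
  brownian_indep : forall t : nat -> R, 0 <= t 0%N ->
    (forall n, t n <= t n.+1) ->
    independent_RVs P (fun n w => B (t n.+1) w - B (t n) w : R) ;
  brownian_cont : {ae P, forall w,
    {within [set s : R | 0 <= s], continuous (fun s => B s w)}}
}.
Arguments brownian_motion {d Omega R} P B.

Record brownian_nodes {d} {Omega : measurableType d} {R : realType}
    (P : probability Omega R) (lambda : R) (X : nat -> {RV P >-> R})
    (xi : nat -> R -> {RV P >-> R}) : Prop := {
  nodes_poisson : poisson_process P lambda X ;
  nodes_brownian : forall i, brownian_motion P (xi i) ;
  (* [None] indexes the whole sequence of initial positions, [Some i] the whole
     trajectory of the i-th displacement. *)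
  nodes_indep : mutually_independent P (fun o : option nat =>
    if o is Some i
    then sigma_of_family (fun s => xi i s : Omega -> R) [set s | 0 <= s]
    else sigma_of_family (fun i => X i : Omega -> R) setT)
}.
Arguments brownian_nodes {d Omega R} P lambda X xi.

(* Equal to [+oo] when the origin stays covered forever. *)
Definition T_isol {R : realType} {Omega : Type} (r : R) (X : nat -> Omega -> R)
    (xi : nat -> R -> Omega -> R) (w : Omega) : \bar R :=
  ereal_inf [set t%:E | t in [set t : R | 0 <= t /\
    ~ (\bigcup_i closed_ball (X i w + xi i t w) r) 0]].

(* [P] itself when [E] is measurable, and its completion when [E] is measurable
   for the completed sigma-algebra.  The event [T_isol > t] is only of the
   latter kind in general: it involves uncountably many times, and the paths
   and the point configuration are regular only almost surely. *)
Definition inner_prob {d} {Omega : measurableType d} {R : realType}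
    (P : probability Omega R) (E : set Omega) : \bar R :=
  ereal_sup [set P A | A in [set A | measurable A /\ A `<=` E]].

(* Main.v *)
(* Put n0 ~ 12 ln t nodes in each cell of width r/3 of an interval of length of
   order sqrt t; by independence of the Poisson counts and n0! <= n0^n0 this has
   probability exp (- O (sqrt t * ln t * ln (ln t))).  On that event the origin
   stays covered with probability at least 1/2.  Indeed, the translates by the
   cells of the event "the node is near the origin at time u" cover the event
   that a single Brownian motion is at distance at most 2 sqrt t from its start,
   so the hitting probabilities sum to at least 1/4 over the cells, and all nodes
   miss with probability at most exp (- n0 / 4).  A union bound over a time grid
   of polynomial size suffices, because between grid times the oscillation of the
   nodes is controlled by dyadic chaining and a Gaussian tail bound.
   The initial positions enter only through the finite label "which of the first
   L nodes lies in which cell", so that conditioning on them is a finite sum. *)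
Require Import Defs.
From HB Require Import structures.
From mathcomp Require Import all_boot all_order all_algebra.
From mathcomp Require Import all_classical all_reals all_analysis measurable_realfun.
From mathcomp Require Import finmap ring lra zify.
Set Implicit Arguments.
Unset Strict Implicit.
Unset Printing Implicit Defensive.
Import Order.TTheory GRing.Theory Num.Theory.
Import numFieldNormedType.Exports.
Local Open Scope classical_set_scope.
Local Open Scope ring_scope.

(** * Gaussian tail bounds, for the normal law and for Brownian increments *)

Section normal_tail.
Context {R : realType}.
Implicit Types (s a x : R).

(* Exponential tilting: with [theta = a / s ^+ 2] the total mass 1 of the shifted
   density yields the Chernoff bound. *)
Lemma normal_pdf_tilt s theta x : s != 0 ->
  expR (theta * x) * normal_pdf 0 s x =
  expR (theta ^+ 2 * s ^+ 2 / 2) * normal_pdf (theta * s ^+ 2) s x.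
Proof.
move=> s0; rewrite !normal_pdfE// !(mulrCA (expR _)) /normal_fun -!expRD.
congr (_ * expR _); field; exact: s0.
Qed.

Lemma normal_prob_half_tail s a : 0 < s -> 0 < a ->
  (normal_prob 0 s [set x | (a < x)%R]
    <= (expR (- (a ^+ 2 / (2 * s ^+ 2))))%:E)%E /\
  (normal_prob 0 s [set x | (a < - x)%R]
    <= (expR (- (a ^+ 2 / (2 * s ^+ 2))))%:E)%E.
Proof.
move=> s0 a0.
have sn0 : s != 0 by rewrite gt_eqF.
(* One bound serves both tails, with [theta] equal to [a / s ^+ 2] or its opposite. On [A] one has
   [1 <= expR (theta * x - a ^+ 2 / s ^+ 2)], so the density is at most
   [expR (- (a ^+ 2 / (2 * s ^+ 2)))] times the shifted density. *)
have bound (theta : R) (A : set R) : measurable A ->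
    (forall x, A x -> a ^+ 2 / s ^+ 2 <= theta * x) ->
    theta ^+ 2 = (a / s ^+ 2) ^+ 2 ->
    (normal_prob 0 s A <= (expR (- (a ^+ 2 / (2 * s ^+ 2))))%:E)%E.
  move=> mA Ax thetaE; rewrite /normal_prob.
  set C := expR (- _).
  have mpdf m : measurable_fun A (fun x => (normal_pdf m s x)%:E).
    apply/measurable_EFinP/(measurable_funS measurableT) => //.
    exact: measurable_normal_pdf.
  apply: (@le_trans _ _ (\int[lebesgue_measure]_(x in A)
      (C%:E * (normal_pdf (theta * s ^+ 2) s x)%:E))%E).
    apply: ge0_le_integral => //.
    - by move=> x _; rewrite lee_fin normal_pdf_ge0.
    - exact: mpdf.
    - by apply: measurable_funeM; exact: mpdf.
    - move=> x /Ax ax; rewrite -EFinM lee_fin.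
      have := normal_pdf_tilt theta x sn0.
      rewrite thetaE => /(congr1 (fun y => expR (- (a ^+ 2 / s ^+ 2)) * y)).
      rewrite mulrA [in RHS]mulrA -!expRD => E.
      have -> : C = expR (- (a ^+ 2 / s ^+ 2) + (a / s ^+ 2) ^+ 2 * s ^+ 2 / 2).
        by congr expR; field.
      rewrite -E ler_peMl ?normal_pdf_ge0//.
      by rewrite (le_trans _ (expR_ge1Dx _))// lerDl addrC subr_ge0.
  rewrite ge0_integralZl//; last 3 first.
  - exact: mpdf.
  - by move=> x _; rewrite lee_fin normal_pdf_ge0.
  - by rewrite lee_fin expR_ge0.
  rewrite -[leRHS]mule1; apply: lee_wpmul2l; first by rewrite lee_fin expR_ge0.
  rewrite -(integral_normal_pdf (theta * s ^+ 2) s).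
  apply: ge0_subset_integral => //.
    by apply/measurable_EFinP; exact: measurable_normal_pdf.
  by move=> x _; rewrite lee_fin normal_pdf_ge0.
have s2 : 0 < s ^+ 2 by rewrite exprn_gt0.
split.
  apply: (bound (a / s ^+ 2)) => //.
    rewrite (_ : [set x | _] = `]a, +oo[%classic); first exact: measurable_itv.
    by apply/seteqP; split => x /=; rewrite in_itv/= andbT.
  move=> x /= ax; rewrite expr2 mulrAC ler_pM2l ?divr_gt0//; exact: ltW.
apply: (bound (- (a / s ^+ 2))) => //; last by rewrite sqrrN.
  rewrite (_ : [set x | _] = `]-oo, (- a)[%classic); first exact: measurable_itv.
  by apply/seteqP; split => x /=; rewrite in_itv/= ltrNr.
move=> x /= ax; rewrite mulNr -mulrN expr2 mulrAC ler_pM2l ?divr_gt0//; exact: ltW.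
Qed.

Lemma normal_prob_tail s a : 0 < s -> 0 < a ->
  (normal_prob 0 s [set x | a < `|x|]%R
    <= (2 * expR (- (a ^+ 2 / (2 * s ^+ 2))))%:E)%E.
Proof.
move=> s0 a0; have [h1 h2] := normal_prob_half_tail s0 a0.
have mr : measurable [set x : R | a < x].
  rewrite (_ : [set x | _] = `]a, +oo[%classic); first exact: measurable_itv.
  by apply/seteqP; split => x /=; rewrite in_itv/= andbT.
have ml : measurable [set x : R | a < - x].
  rewrite (_ : [set x | _] = `]-oo, (- a)[%classic); first exact: measurable_itv.
  by apply/seteqP; split => x /=; rewrite in_itv/= ltrNr.
rewrite (_ : [set x | _] = [set x | a < x] `|` [set x | a < - x]); last first.
  apply/seteqP; split => x /=; rewrite ltr_normr; first by case/orP; [left|right].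
  by case=> ->; rewrite ?orbT.
apply: le_trans (@measureU2 _ _ _ (normal_prob 0 s) _ _ mr ml) _.
by rewrite mulr2n mulrDl mul1r EFinD leeD.
Qed.

End normal_tail.

Lemma measurable_gt_norm {R : realType} (a : R) : measurable [set x : R | a < `|x|].
Proof.
have := @normr_measurable R setT measurableT _ (measurable_itv `]a, +oo[).
rewrite setTI; congr measurable.
by apply/seteqP; split => x /=; rewrite in_itv/= andbT.
Qed.

Section brownian_tail.
Context {R : realType} {d} {Omega : measurableType d} {P : probability Omega R}.
Context {B : R -> {RV P >-> R}} (BM : brownian_motion P B).

Lemma brownian_incr_tail (s t a : R) : 0 <= s -> s < t -> 0 < a ->
  (P [set w | a < `|B t w - B s w|]%R
    <= (2 * expR (- (a ^+ 2 / (2 * (t - s)))))%:E)%E.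
Proof.
move=> s0 st a0; have := brownian_gauss BM s0 st (measurable_gt_norm a) => /= ->.
have ts : 0 < t - s by rewrite subr_gt0.
have := @normal_prob_tail R (Num.sqrt (t - s)) a.
rewrite sqrtr_gt0 => /(_ ts a0).
by rewrite sqr_sqrtr// ltW.
Qed.

End brownian_tail.

(** * Dyadic chaining: oscillation of a continuous path over a short time interval *)

Section chaining.
Context {R : realType}.
Variables (f : R -> R) (u0 delta a beta : R).
Hypotheses (u0_ge0 : 0 <= u0) (delta_gt0 : 0 < delta) (a_ge0 : 0 <= a).
Hypotheses (beta_ge0 : 0 <= beta) (beta_lt1 : beta < 1).

Definition dyadic (n l : nat) : R := u0 + l%:R * (delta / (2 ^ n)%:R).

Lemma dyadicS n l : dyadic n.+1 l.*2 = dyadic n l.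
Proof.
rewrite /dyadic expnS -mul2n !natrM; field.
by rewrite pnatr_eq0 expn_eq0.
Qed.

Hypothesis fcont : {within [set s : R | 0 <= s], continuous f}.
Hypothesis fosc : forall n l, (l < 2 ^ n)%N ->
  `|f (dyadic n l.+1) - f (dyadic n l)| <= a * beta ^+ n.

(** Approximate [u] from below by its binary truncations relative to [u0] and [delta]. Consecutive
    truncations are equal or adjacent in the finer grid, so the increments telescope into a
    geometric series, and continuity gives the limit. *)
Lemma dyadic_chaining u : u0 <= u -> u < u0 + delta ->
  `|f u - f u0| <= a / (1 - beta).
Proof.
move=> u0u uud.
pose v := (u - u0) / delta.
have v0 : 0 <= v by rewrite divr_ge0 ?subr_ge0// ltW.
have v1 : v < 1 by rewrite ltr_pdivrMr// mul1r ltrBlDl.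
have p2 n : 0 < (2 ^ n)%:R :> R by rewrite ltr0n expn_gt0.
pose l n := Num.truncn (v * (2 ^ n)%:R).
have lv n : (l n)%:R <= v * (2 ^ n)%:R < (l n).+1%:R.
  by apply: truncn_itv; rewrite mulr_ge0// ltW.
have l2n n : (l n < 2 ^ n)%N.
  rewrite /l truncn_lt_nat; last by rewrite mulr_ge0// ltW.
  by rewrite -[ltRHS]mul1r ltr_pM2r.
have lS n : l n.+1 = (l n).*2 \/ l n.+1 = (l n).*2.+1.
  have /andP[la lb] := lv n.
  have E : v * (2 ^ n.+1)%:R = v * (2 ^ n)%:R * 2.
    by rewrite expnS natrM mulrCA mulrC.
  have h1 : ((l n).*2 <= l n.+1)%N.
    rewrite /l truncn_ge_nat; last by rewrite mulr_ge0// ltW.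
    by rewrite -muln2 natrM E ler_pM2r.
  have h2 : (l n.+1 < (l n).+1.*2)%N.
    rewrite /l truncn_lt_nat; last by rewrite mulr_ge0// ltW.
    by rewrite -muln2 natrM E ltr_pM2r.
  by move: h1 h2; lia.
pose b n := dyadic n (l n).
have l0 : l 0%N = 0%N.
  by have := l2n 0%N; rewrite expn0; case: (l 0%N).
have b0 : b 0%N = u0 by rewrite /b l0 /dyadic mul0r addr0.
have bb n : `|f (b n.+1) - f (b n)| <= a * beta ^+ n.+1.
  rewrite /b -(dyadicS n (l n)); case: (lS n) => ->.
    by rewrite subrr normr0 mulr_ge0// exprn_ge0.
  by apply: fosc; rewrite expnS mul2n ltn_double l2n.
(* Level 0 contributes nothing since [b 0 = u0]; the right side is the sum of [a * beta ^+ k] for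
   [k] from 1 to [n]. *)
have bsum n : `|f (b n) - f u0| <= a / (1 - beta) * (beta - beta ^+ n.+1).
  elim: n => [|n ih]; first by rewrite b0 expr1 !subrr mulr0 normr0.
  rewrite -(subrKA (f (b n))) (le_trans (ler_normD _ _))//.
  apply: (le_trans (lerD (bb n) ih)).
  have h : 1 - beta != 0 by rewrite gt_eqF// subr_gt0.
  rewrite -subr_ge0 (_ : _ - _ = 0)//.
  by rewrite !exprS; field.
have bu n : u - delta / (2 ^ n)%:R <= b n <= u.
  have /andP[la lb] := lv n.
  have uE : u = u0 + (v * (2 ^ n)%:R) * (delta / (2 ^ n)%:R).
    rewrite /v; field.
    by rewrite !gt_eqF.
  rewrite /b /dyadic; apply/andP; split; last first.
    by rewrite [leRHS]uE lerD2l ler_pM2r// divr_gt0.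
  rewrite lerBlDr -addrA -[X in _ + (_ + X)]mul1r -mulrDl natr1 [leLHS]uE.
  rewrite lerD2l ler_pM2r ?divr_gt0//.
  exact: ltW.
have b_ge0 n : 0 <= b n.
  by rewrite /b /dyadic addr_ge0// mulr_ge0// divr_ge0// ltW.
have b_cvg : b @ \oo --> u.
  apply: (@squeeze_cvgr _ _ _ _ (fun n => u - delta / (2 ^ n)%:R) (fun=> u)).
  - by near=> n; apply: bu.
  - rewrite -[X in _ --> X]subr0; apply: cvgB; first exact: cvg_cst.
    rewrite -[X in _ --> X](mulr0 delta); apply: cvgM; first exact: cvg_cst.
    under eq_cvg do rewrite natrX -exprVn.
    by apply: cvg_expr; rewrite ger0_norm ?invr_ge0// invf_lt1// ltr1n.
  - exact: cvg_cst.
have fb_cvg : (f \o b) @ \oo --> f u.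
  have u_ge0 : 0 <= u by exact: le_trans u0u.
  have /subspace_continuousP/(_ u u_ge0) fu := fcont.
  (* Continuity is only relative to nonnegative times, so [b] must converge within that set. *)
  have bw : b @ \oo --> within [set s : R | 0 <= s] (nbhs u).
    move=> A /= Au; have := b_cvg _ Au => /=.
    by apply: (@filterS _ \oo) => n; apply; exact: b_ge0.
  exact: cvg_comp bw fu.
have h : (fun n => `|f (b n) - f u0|) @ \oo --> `|f u - f u0|.
  by apply: cvg_norm; apply: cvgB => //; exact: cvg_cst.
rewrite -(cvg_lim _ h)//; apply: limr_le; first by apply/cvg_ex; exists `|f u - f u0|.
near=> n; apply: le_trans (bsum n) _.
rewrite ler_piMr//; first by rewrite divr_ge0// subr_ge0 ltW.
by rewrite lerBlDr (le_trans (ltW beta_lt1))// lerDl exprn_ge0.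
Unshelve. all: by end_near.
Qed.

End chaining.

Section oscillation.
Context {R : realType}.
Implicit Types (delta a : R).

(* The ratio 7/8 makes the thresholds summable with sum [8 * a], while their
   squares decay more slowly than the variances [delta / 2 ^ n]. *)
Definition oscillates {T : Type} (Y : R -> T -> R) (u0 : R) delta a : set T :=
  \bigcup_n \bigcup_(l in `I_(2 ^ n)) [set w |
    a * (7 / 8) ^+ n
      < `|Y (dyadic u0 delta n l.+1) w - Y (dyadic u0 delta n l) w|].

Lemma dyadic_ge0 (u0 : R) delta n l : 0 <= u0 -> 0 < delta -> 0 <= dyadic u0 delta n l.
Proof. by move=> u0_ge0 /ltW d0; rewrite /dyadic addr_ge0// mulr_ge0// divr_ge0. Qed.

Lemma measurable_oscillates d (T : measurableType d) (Y : R -> T -> R) (u0 : R) delta a :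
  0 <= u0 -> 0 < delta ->
  (forall u, 0 <= u -> measurable_fun setT (Y u)) ->
  measurable (oscillates Y u0 delta a).
Proof.
move=> u0_ge0 d0 mY; apply: bigcupT_measurable => n.
apply: bigcup_measurable => l _.
have := measurable_funB (mY _ (dyadic_ge0 n l.+1 u0_ge0 d0))
  (mY _ (dyadic_ge0 n l u0_ge0 d0)).
by move=> /(_ measurableT _ (measurable_gt_norm (a * (7 / 8) ^+ n))); rewrite setTI.
Qed.

Lemma oscillates_control {T : Type} (Y : R -> T -> R) (u0 : R) delta a w u :
  0 <= u0 -> 0 < delta -> 0 <= a ->
  {within [set s : R | 0 <= s], continuous (Y ^~ w)} ->
  ~ oscillates Y u0 delta a w -> u0 <= u -> u < u0 + delta ->
  `|Y u w - Y u0 w| <= 8 * a.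
Proof.
move=> u0_ge0 d0 a0 cY nosc uu uu'.
rewrite (_ : 8 * a = a / (1 - 7 / 8)); last by field.
have [b0 b1] : 0 <= 7 / 8 :> R /\ 7 / 8 < 1 :> R by split; lra.
apply: (@dyadic_chaining _ (Y ^~ w) u0 delta a (7 / 8)) => //.
move=> n l ln; rewrite leNgt; apply/negP => h; apply: nosc.
by exists n => //; exists l.
Qed.

(** Here [49 / 32 = 2 * (7 / 8) ^+ 2] is the factor by which the ratio of squared threshold to
    variance grows from one dyadic level to the next. An affine lower bound is enough to make the
    Gaussian tails decay geometrically in the level. *)
Lemma affine_le_expr (n : nat) : 1 + n%:R / 2 <= (49 / 32) ^+ n :> R.
Proof.
elim: n => [|n ih]; first by rewrite expr0 mul0r addr0.
rewrite exprS -natr1; have : 0 <= n%:R :> R by [].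
by move: (n%:R) ih => x; set y := _ ^+ _; lra.
Qed.

Context {d} {Omega : measurableType d} {P : probability Omega R}.
Context {B : R -> {RV P >-> R}} (BM : brownian_motion P B).

(** Union bound: each of the [2 ^ n] increments at level [n] exceeds its threshold with probability
    at most [2 * expR (- y) * 4^-1 ^+ n], so level [n] costs [2 * expR (- y) / 2 ^+ n], and the
    levels sum to [4 * expR (- y)]. *)
Lemma brownian_oscillates (u0 delta a y : R) : 0 <= u0 -> 0 < delta -> 0 < a ->
  6 <= y -> y = a ^+ 2 / (2 * delta) ->
  (P (oscillates (fun u => B u : Omega -> R) u0 delta a)
     <= (4 * expR (- y))%:E)%E.
Proof.
move=> u0_ge0 d0 a0 y6 yE.
have mB u : 0 <= u -> measurable_fun setT (B u : Omega -> R) by [].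
pose E n l : set Omega := [set w | a * (7 / 8) ^+ n
      < `|B (dyadic u0 delta n l.+1) w - B (dyadic u0 delta n l) w|].
have mE n l : measurable (E n l).
  have := measurable_funB (mB _ (dyadic_ge0 n l.+1 u0_ge0 d0))
    (mB _ (dyadic_ge0 n l u0_ge0 d0)).
  by move=> /(_ measurableT _ (measurable_gt_norm (a * (7 / 8) ^+ n))); rewrite setTI.
have mosc := @measurable_oscillates _ _ (fun u => B u : Omega -> R) u0 delta a u0_ge0 d0 mB.
have mUE n : measurable (\bigcup_(l in `I_(2 ^ n)) E n l).
  by apply: bigcup_measurable => l _; exact: mE.
apply: le_trans (measure_sigma_subadditive P mUE mosc _) _; first by [].
apply: le_trans (epsilon_trick0 xpredT _); last by rewrite mulr_ge0// expR_ge0.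
apply: lee_nneseries => // n _.
rewrite bigcup_mkord.
apply: le_trans (Boole_inequality P (fun l _ => mE n l)) _.
(* This is where [6 <= y] enters: [expR (y / 2) >= 1 + y / 2 >= 4]. *)
have e4 : expR (- (y / 2)) <= 4^-1.
  rewrite expRN lef_pV2 ?posrE ?expR_gt0//.
  by apply: le_trans (expR_ge1Dx _); lra.
have ln l : (P (E n l) <= (2 * (expR (- y) * 4^-1 ^+ n))%:E)%E.
  have dp : 0 < delta / (2 ^ n)%:R by rewrite divr_gt0// ltr0n expn_gt0.
  have dE : dyadic u0 delta n l.+1 - dyadic u0 delta n l = delta / (2 ^ n)%:R.
    by rewrite /dyadic -natr1; ring.
  apply: le_trans (brownian_incr_tail BM _ _ _) _.
  - exact: dyadic_ge0.
  - by rewrite -subr_gt0 dE.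
  - by rewrite mulr_gt0// exprn_gt0// divr_gt0.
  rewrite lee_fin ler_pM2l// dE.
  apply: (@le_trans _ _ (expR (- (y * (1 + n%:R / 2))))).
    rewrite ler_expR lerN2.
    rewrite [leRHS](_ : _ = y * (49 / 32) ^+ n); last first.
      rewrite yE natrX exprMn -exprM mulnC exprM.
      rewrite (_ : (7 / 8) ^+ 2 = 49 / 64 :> R); last by field.
      rewrite (_ : 49 / 32 = (49 / 64) * 2 :> R); last by field.
      move: (49 / 64 : R) => q; rewrite exprMn; field.
      by rewrite gt_eqF//= gt_eqF// exprn_gt0.
    by rewrite ler_pM2l ?affine_le_expr//; lra.
  rewrite mulrDr mulr1 opprD expRD ler_pM2l ?expR_gt0//.
  rewrite (_ : - (y * (n%:R / 2)) = n%:R * (- (y / 2))); last by field.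
  by rewrite expRM_natl lerXn2r ?nnegrE ?expR_ge0 ?invr_ge0.
apply: (@le_trans _ _ (\sum_(l < 2 ^ n) (2 * (expR (- y) * 4^-1 ^+ n))%:E)%E).
  by apply: lee_sum => l _; exact: ln.
rewrite sumEFin sumr_const card_ord lee_fin -[leLHS]mulr_natr !natrX.
rewrite (_ : 4^-1 ^+ n = (2 ^+ n)^-1 * (2 ^+ n)^-1 :> R); last first.
  rewrite (_ : 4^-1 = 2^-1 * 2^-1 :> R); first by rewrite exprMn exprVn.
  by field.
rewrite exprS le_eqVlt; apply/orP; left; apply/eqP; field.
by rewrite gt_eqF// exprn_gt0.
Qed.

End oscillation.

(** * Independence and comparison of measures *)

Section independence.
Context {R : realType} {d} {Omega : measurableType d} {P : probability Omega R}.

Lemma sigma_of_family_measurable_fun {I : Type} (Y : I -> Omega -> R) (D : set I) i :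
  D i ->
  @measurable_fun _ _
    (g_sigma_algebraType (\bigcup_(i in D) preimage_set_system setT (Y i) measurable))
    R setT (Y i).
Proof.
by move=> Di _ A mA; apply: sub_sigma_algebra; exists i => //; exists A.
Qed.

Lemma mutually_independent_list (F : option nat -> set_system Omega)
    (L : nat) (A : set Omega) (E : nat -> set Omega) :
  (forall o, F o setT) -> mutually_independent P F -> F None A ->
  (forall i, (i < L)%N -> F (Some i) (E i)) ->
  P (A `&` \bigcap_(i in `I_L) E i) = (P A * \prod_(i < L) P (E i))%E.
Proof.
move=> FT ind FA FE.
(* Independence asks for an event of the family at every index, so the indices from [L] on receive
   the full event. *)
pose G (o : option nat) := match o with
  None => A | Some i => if (i < L)%N then E i else setT end.
have FG o : F o (G o).
  by case: o => [i|] //=; case: ifPn => // /FE.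
have := ind (None |` [fset Some (val i) | i in 'I_L])%fset G FG.
rewrite big_fsetU1 /=; last first.
  by apply/negP => /imfsetP[].
rewrite big_imfset/=; last by move=> i j _ _ [] /val_inj.
rewrite big_enum /= => E1.
rewrite (_ : A `&` _ =
    \bigcap_(i in [set` (None |` [fset Some (val i) | i in 'I_L])%fset]) G i).
  by rewrite E1; congr *%E; apply: eq_big => // i _; rewrite ltn_ord.
rewrite set_fsetU1 bigcap_setU1; congr (_ `&` _).
apply/seteqP; split => w h /=.
  by move=> o /= /imfsetP[i _ ->] /=; rewrite ltn_ord; apply: h; exact: ltn_ord.
move=> i iL; have /= := h (Some i); rewrite iL; apply.
by apply/imfsetP; exists (Ordinal iL).
Qed.

End independence.

Lemma prod_le_expR {R : realType} (I : finType) (p : I -> R) :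
  (forall i, 0 <= p i <= 1) ->
  \prod_i (1 - p i) <= expR (- \sum_i p i).
Proof.
move=> p01; rewrite -sumrN expR_sum.
apply: ler_prod => i _; have /andP[? ?] := p01 i.
by rewrite subr_ge0; apply/andP; split => //; exact: expR_ge1Dx.
Qed.

Lemma measure_mono {R : realType} d (T : measurableType d)
    (mu : {measure set T -> \bar R}) (A B : set T) :
  measurable A -> measurable B -> A `<=` B -> (mu A <= mu B)%E.
Proof. by move=> mA mB; apply: le_measure; exact: mem_set. Qed.

Lemma ae_measure_eq {R : realType} d (T : measurableType d)
    (mu : {measure set T -> \bar R}) (A B : set T) :
  measurable A -> measurable B -> {ae mu, forall w, A w <-> B w} -> mu A = mu B.
Proof.
move=> mA mB [N [mN N0 hN]].
have le (C D : set T) : measurable C -> measurable D ->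
    (forall w, ~ N w -> C w -> D w) -> (mu C <= mu D)%E.
  move=> mC mD CD; rewrite -[leRHS]adde0 -N0.
  apply: le_trans (measureU2 _ mD mN); apply: measure_mono => //.
    exact: measurableU.
  by move=> w Cw; have [Nw|Nw] := pselect (N w); [right|left; exact: CD].
have AB w : ~ N w -> (A w <-> B w) by move=> Nw; apply: contrapT => /hN.
by apply/eqP; rewrite eq_le; apply/andP; split; apply: le => // w /AB [].
Qed.

(** * One-time marginals of Brownian motion *)

Section brownian_marginal.
Context {R : realType} {d} {Omega : measurableType d} {P : probability Omega R}.

(** Only increments have a prescribed law; since [B 0] vanishes almost surely, the marginal is that
    of the increment from time 0. *)
Lemma brownian_marginal (B : R -> {RV P >-> R}) u (A : set R) :
  brownian_motion P B -> measurable A ->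
  P [set w | A (B u w)] = P [set w | A (B u w - B 0 w)].
Proof.
move=> BM mA; apply: ae_measure_eq.
- have := @measurable_funPT _ _ _ _ (B u) measurableT _ mA.
  by rewrite setTI.
- have := measurable_funB (@measurable_funPT _ _ _ _ (B u))
    (@measurable_funPT _ _ _ _ (B 0)).
  by move=> /(_ measurableT _ mA); rewrite setTI.
- have [N [mN N0 hN]] := brownian_start BM; exists N; split => // w /= h.
  by apply: hN => /= B0; apply: h; rewrite B0 subr0.
Qed.

Lemma brownian_same_law (B1 B2 : R -> {RV P >-> R}) u (A : set R) :
  brownian_motion P B1 -> brownian_motion P B2 -> 0 <= u -> measurable A ->
  P [set w | A (B1 u w)] = P [set w | A (B2 u w)].
Proof.
(* Time 0 is separate: [brownian_gauss] needs strictly ordered times, and at time 0 both increments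
   are identically 0. *)
move=> BM1 BM2; rewrite le_eqVlt => /predU1P[<-|u0] mA.
  rewrite (brownian_marginal _ BM1)// (brownian_marginal _ BM2)//.
  by congr (P _); apply/seteqP; split => w /=; rewrite !subrr.
rewrite (brownian_marginal _ BM1)// (brownian_marginal _ BM2)//.
by rewrite (brownian_gauss BM1)// (brownian_gauss BM2).
Qed.

Lemma brownian_tail (B : R -> {RV P >-> R}) (u v a : R) :
  brownian_motion P B -> 0 <= u -> u <= v -> 0 < v -> 0 < a ->
  (P [set w | a < `|B u w|]%R <= (2 * expR (- (a ^+ 2 / (2 * v))))%:E)%E.
Proof.
move=> BM u0 uv v0 a0.
rewrite (@brownian_marginal _ u [set x | a < `|x|] BM (measurable_gt_norm a)).
move: u0; rewrite le_eqVlt => /predU1P[<-|u0].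
  rewrite (_ : [set _ | _] = set0); last first.
    by apply/seteqP; split => w //=; rewrite subrr normr0 ltNge ltW.
  by rewrite measure0 lee_fin mulr_ge0// expR_ge0.
apply: le_trans (brownian_incr_tail BM _ u0 a0) _ => //.
rewrite subr0 lee_fin ler_pM2l// ler_expR lerN2.
by rewrite ler_pM2l ?exprn_gt0// lef_pV2 ?posrE ?mulr_gt0// ler_pM2l.
Qed.

Lemma brownian_tail_half (B : R -> {RV P >-> R}) (u s : R) :
  brownian_motion P B -> 0 <= u -> u <= s ^+ 2 -> 0 < s ->
  (P [set w | 2 * s < `|B u w|]%R <= (2^-1)%:E)%E.
Proof.
move=> BM u0 us s0.
apply: le_trans (@brownian_tail B u (s ^+ 2) (2 * s) BM u0 us _ _) _.
- by rewrite exprn_gt0.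
- by rewrite mulr_gt0.
rewrite lee_fin (_ : _ / _ = 2); last by field; rewrite gt_eqF.
(* The tail bound is now [2 * expR (- 2)], which is at most 1/2. *)
have e4 : 4 <= expR 2 :> R.
  rewrite (_ : 2 = 1 + 1 :> R)// expRD (_ : 4 = (1 + 1) * (1 + 1) :> R).
    by apply: ler_pM => //; exact: expR_ge1Dx.
  by ring.
have : expR (- 2) <= 4^-1 :> R by rewrite expRN lef_pV2 ?posrE ?expR_gt0.
by move: (expR _) => e; lra.
Qed.

End brownian_marginal.

Lemma measurable_near {R : realType} d (T : measurableType d) (f : T -> R) (h c : R) :
  measurable_fun setT f -> measurable [set w | `|c + f w| <= h].
Proof.
move=> mf.
have := measurable_funD (@measurable_cst _ _ _ _ setT c) mf.
move=> /(_ measurableT _ (measurableC (measurable_gt_norm h))).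
rewrite setTI; congr measurable; apply/seteqP.
by split => w /= => [/negP|hw]; [|apply/negP]; rewrite -leNgt.
Qed.

(** * Cells of starting points and their hitting probabilities *)

Section cells.
Context {R : realType}.
Variables (h : R) (M : nat).
Hypothesis h0 : 0 < h.

(* The cells of index [m < M.*2] tile [[- M h, M h[]. *)
Definition cell_pos (m : nat) : R := (m%:R - M%:R) * h.
Definition cell (m : nat) : set R := `[cell_pos m, cell_pos m.+1[%classic.

Lemma cell_posS m : cell_pos m.+1 = cell_pos m + h.
Proof. by rewrite /cell_pos -natr1; ring. Qed.

Lemma measurable_cell m : measurable (cell m).
Proof. exact: measurable_itv. Qed.

Lemma cell_dist m x : cell m x -> `|x - cell_pos m| <= h.
Proof.
rewrite /cell /= in_itv /= cell_posS => /andP[h1 h2].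
by rewrite ger0_norm ?subr_ge0// lerBlDl ltW.
Qed.

Lemma cell_exists x : - (M%:R * h) <= x -> x < M%:R * h ->
  exists2 m, (m < M.*2)%N & cell m x.
Proof.
move=> x1 x2; pose v := (x + M%:R * h) / h.
have v0 : 0 <= v by rewrite divr_ge0 ?(ltW h0)// -[x]opprK addrC subr_ge0 lerNl.
have xE : x = (v - M%:R) * h by rewrite /v; field; rewrite gt_eqF.
exists (Num.truncn v).
  rewrite truncn_lt_nat// -addnn natrD /v ltr_pdivrMr// mulrDl.
  by rewrite ltrD2r.
have /andP[v1 v2] := truncn_itv v0.
rewrite /cell /= in_itv /cell_pos {1 2}xE /= ler_pM2r// lerD2r v1 /=.
by rewrite ltr_pM2r// ltrD2r.
Qed.

Lemma trivIset_cell : trivIset setT cell.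
Proof.
apply/trivIsetP => i j _ _ ij.
wlog lij : i j ij / (i < j)%N.
  move=> H; case: (ltngtP i j) => [|ji|e]; [exact: H| |by rewrite e eqxx in ij].
  by rewrite setIC; apply: H; rewrite // eq_sym.
rewrite -subset0 => x /=; rewrite /cell/= !in_itv/= => -[/andP[_ x1] /andP[x2 _]].
have := le_lt_trans x2 x1; rewrite /cell_pos ltr_pM2r// ltrD2r ltr_nat.
by rewrite ltnS leqNgt lij.
Qed.

Lemma lebesgue_measure_cell m : lebesgue_measure (cell m) = h%:E.
Proof.
rewrite /cell lebesgue_measure_itv/= lte_fin cell_posS ltrDl h0.
by rewrite -EFinD addrAC subrr add0r.
Qed.

Context {d} {Omega : measurableType d} {P : probability Omega R}.
Context {B : R -> {RV P >-> R}} (BM : brownian_motion P B).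

(** If [B u] has absolute value at most [2 * s], then [- B u] falls into some cell, whose left end
    lies within [h] of it and is thus carried near the origin. So the events in the sum cover an
    event of probability at least 1/2, and subadditivity concludes. *)
Lemma cells_hit_ge (u s : R) : 0 < s -> 2 * s < M%:R * h ->
  0 <= u -> u <= s ^+ 2 ->
  2^-1 <= \sum_(m < M.*2) fine (P [set w | `|cell_pos m + B u w| <= h]%R).
Proof.
move=> s0 sM u0 us.
pose H m : set Omega := [set w | `|cell_pos m + B u w| <= h].
have mB : measurable_fun setT (B u : Omega -> R) by [].
have mH m : measurable (H m) by exact: measurable_near.
have mT : measurable [set w | 2 * s < `|B u w|]%R.
  by have := mB measurableT _ (measurable_gt_norm (2 * s)); rewrite setTI.
rewrite -lee_fin -sumEFin.
rewrite (eq_bigr (fun m : 'I__ => P (H m))); last first.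
  by move=> m _; exact: fineK (fin_num_measure P _ (mH m)).
apply: le_trans (Boole_inequality P (fun m _ => mH m)).
apply: (@le_trans _ _ (P (~` [set w | 2 * s < `|B u w|]%R))).
  rewrite probability_setC//.
  have := brownian_tail_half BM u0 us s0.
  rewrite -(fineK (fin_num_measure P _ mT)) -EFinB !lee_fin.
  by lra.
apply: measure_mono.
- exact: measurableC.
- by apply: bigsetU_measurable.
move=> w /= /negP; rewrite -leNgt ler_norml => /andP[w1 w2].
have [||m mM cm] := @cell_exists (- B u w).
- by rewrite lerN2 ltW// (le_lt_trans w2).
- by rewrite ltrNl (lt_le_trans _ w1)// ltrN2.
rewrite -bigcup_mkord; exists m => //=.
by have := cell_dist cm; rewrite -normrN opprB opprK.
Qed.

End cells.

Section hits.
Context {R : realType}.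
Variables (h delta a : R).
Hypotheses (delta0 : 0 < delta) (a0 : 0 < a).

(** The path starts at a deterministic point [c], later the left end of the node's cell, rather than
    at the node itself. The event then depends on the displacement alone, which lets independence
    from the positions be used. *)
Definition hits {T : Type} (Y : R -> T -> R) (c u : R) : set T :=
  [set w | `|c + Y u w| <= h] `\` oscillates Y u delta a.

Lemma measurable_hits d (T : measurableType d) (Y : R -> T -> R) (c u : R) :
  0 <= u -> (forall v, 0 <= v -> measurable_fun setT (Y v)) ->
  measurable (hits Y c u).
Proof.
move=> u0 mY; apply: measurableD.
  by apply: measurable_near; exact: mY.
exact: measurable_oscillates.
Qed.

Context {d} {Omega : measurableType d} {P : probability Omega R}.

Lemma brownian_hits_ge (B : R -> {RV P >-> R}) (c u y : R) :
  brownian_motion P B -> 0 <= u -> 6 <= y -> y = a ^+ 2 / (2 * delta) ->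
  fine (P [set w | `|c + B u w| <= h]%R) - 4 * expR (- y) <=
  fine (P (hits (fun u => B u : Omega -> R) c u)).
Proof.
move=> BM u0 y6 yE.
have mB v : 0 <= v -> measurable_fun setT (B v : Omega -> R) by [].
have mN := measurable_near h c (mB _ u0).
have mO := measurable_oscillates a u0 delta0 mB.
have mH := measurable_hits c u0 mB.
rewrite lerBlDr -lee_fin EFinD fineK ?(fin_num_measure P _ mN)//.
rewrite fineK ?(fin_num_measure P _ mH)//.
apply: le_trans (leeD2l _ (brownian_oscillates BM u0 delta0 a0 y6 yE)).
apply: le_trans (measureU2 _ mH mO); apply: measure_mono => //.
  exact: measurableU.
move=> w hw; case: (pselect (oscillates (fun u => B u : Omega -> R) u delta a w)).
  by right.
by left.
Qed.

End hits.

(** Double counting: after exchanging the sums, each [f m] occurs at least [n] times. *)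
Lemma sum_label_ge {R : realType} (L K n : nat) (g : 'I_L -> option 'I_K)
    (f : 'I_K -> R) : (forall m, 0 <= f m) ->
  (forall m, (n <= #|[pred i | g i == Some m]|)%N) ->
  n%:R * \sum_m f m <= \sum_i oapp f 0 (g i).
Proof.
move=> f0 gn.
have -> : \sum_i oapp f 0 (g i) = \sum_i \sum_(m | g i == Some m) f m.
  apply: eq_bigr => i _; case: (g i) => [m|] /=.
    by rewrite (eq_bigl (pred1 m)) ?big_pred1_eq// => j; rewrite /= eq_sym.
  by rewrite big_pred0.
rewrite (exchange_big_dep xpredT)//= mulr_sumr; apply: ler_sum => m _.
by rewrite sumr_const -[leRHS]mulr_natl; apply: ler_wpM2r => //; rewrite ler_nat; exact: gn.
Qed.

(** * Given a rich label, the origin is hit at all grid times with probability at least 1/2 *)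

Section covering.
Context {R : realType} {d} {Omega : measurableType d} {P : probability Omega R}.
Context {lambda : R} {X : nat -> {RV P >-> R}} {xi : nat -> R -> {RV P >-> R}}.
Hypothesis BN : brownian_nodes P lambda X xi.
Variables (h delta a y s : R) (M n0 N : nat).
Hypotheses (h0 : 0 < h) (delta0 : 0 < delta) (a0 : 0 < a) (s0 : 0 < s).
Hypotheses (y6 : 6 <= y) (yE : y = a ^+ 2 / (2 * delta)).
(** [sM] makes the cells cover [[- 2 * s, 2 * s]]; [yM] limits the loss from oscillations, summed
    over the cells, to half of the hitting mass 1/2; [Ndelta] keeps the grid times below [s ^+ 2];
    [n0N] makes the union bound over the grid at most 1/2. *)
Hypothesis (sM : 2 * s < M%:R * h).
Hypothesis (yM : M.*2%:R * (4 * expR (- y)) <= 4^-1).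
Hypothesis (Ndelta : N%:R * delta <= s ^+ 2).
Hypothesis (n0N : N%:R * expR (- (n0%:R / 4)) <= 2^-1 :> R).

Let K := M.*2.
Let Y i : R -> Omega -> R := fun u => xi i u.
Let pos m : R := cell_pos h M m.
Let time k : R := k%:R * delta.

Let BM i : brownian_motion P (xi i) := nodes_brownian BN i.

Let time_ge0 k : 0 <= time k. Proof. by rewrite mulr_ge0// ltW. Qed.

(* All nodes have the law of node 0.  The lower bound is clamped at 0 so that
   nodes in excess of [n0] in a cell can be ignored. *)
Definition near_weight u m : R :=
  Num.max 0 (fine (P [set w | `|pos m + xi 0%N u w| <= h]%R) - 4 * expR (- y)).

Lemma near_weight_sum u : 0 <= u -> u <= s ^+ 2 ->
  4^-1 <= \sum_(m < K) near_weight u m.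
Proof.
move=> u0 us.
apply: (@le_trans _ _ (\sum_(m < K)
  (fine (P [set w | `|pos m + xi 0%N u w| <= h]%R) - 4 * expR (- y)))); last first.
  by apply: ler_sum => m _; rewrite le_max lexx orbT.
rewrite sumrB sumr_const card_ord -[X in _ - X]mulr_natl.
have := cells_hit_ge h0 (BM 0%N) s0 sM u0 us.
by move: yM; rewrite -/K -/pos; set x := _ * _; set z := \sum_(m < _) _; lra.
Qed.

Lemma near_weight_le i u m : 0 <= u ->
  near_weight u m <= fine (P (hits h delta a (Y i) (pos m) u)).
Proof.
move=> u0; rewrite ge_max fine_ge0//=.
apply: le_trans (brownian_hits_ge h delta0 a0 _ (BM i) u0 y6 yE).
rewrite lerD2r (@brownian_same_law _ _ _ _ (xi 0%N) (xi i) u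
  [set x | `|pos m + x| <= h] (BM 0%N) (BM i))//.
apply: measurable_near; exact: measurable_id.
Qed.

Variable L : nat.
Let config := {ffun 'I_L -> option 'I_K}.

Definition label (w : Omega) : config :=
  [ffun i => [pick m : 'I_K | `[< cell h M m (X (val i) w) >]]].

(** Disjointness of the cells makes the picked index the only possible one. *)
Lemma pick_cell x (m : 'I_K) :
  ([pick m : 'I_K | `[< cell h M m x >]] == Some m) = `[< cell h M m x >].
Proof.
case: pickP => [m' /asboolP cm'|no]; last by rewrite no.
apply/eqP/asboolP => [[<-]//|cm]; congr Some; apply: val_inj.
have /trivIsetP /(_ m' m I I) := @trivIset_cell _ h M h0.
have [//|ne /(_ isT)] := eqVneq (m' : nat) m.
by move=> /seteqP[/(_ x) + _] => /(_ (conj cm' cm)).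
Qed.

Definition rich (g : config) : bool :=
  [forall m, n0 <= #|[pred i | g i == Some m]|]%N.

(** The label [g] is a fixed value here, so the event involves only the displacement of node [i].
    Nodes outside all cells, and indices from [L] on, carry no constraint. *)
Let miss (g : config) k i : set Omega :=
  if obind g (insub i) is Some m
  then ~` hits h delta a (Y i) (pos m) (time k) else setT.

Let sX := sigma_of_family (fun i => X i : Omega -> R) setT.
Let sxi i := sigma_of_family (Y i) [set s | 0 <= s].

Lemma label_sigma (g : config) : sX [set w | label w = g].
Proof.
pose T := g_sigma_algebraType (\bigcup_(i in setT)
  preimage_set_system setT (X i : Omega -> R) measurable).
have mX i : @measurable_fun _ _ T R setT (X i).
  exact: (@sigma_of_family_measurable_fun _ _ _ _ (fun i => X i : Omega -> R)).
change (measurable ([set w | label w = g] : set T)).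
(* The fibres of [label] in one coordinate; [None] stands for the complement of all cells. *)
pose lab (o : option 'I_K) : set R :=
  if o is Some m then cell h M m else ~` \bigcup_(m in `I_K) cell h M m.
have mlab o : measurable (lab o).
  case: o => [m|] /=; first exact: measurable_cell.
  by apply: measurableC; apply: bigcup_measurable => m _; exact: measurable_cell.
have labP o x : lab o x <-> [pick m : 'I_K | `[< cell h M m x >]] = o.
  case: o => [m|].
    split; first by move=> cm; apply/eqP; rewrite pick_cell; apply/asboolP.
    by move=> /eqP; rewrite pick_cell => /asboolP.
  case: pickP => [m /asboolP cm|no]; split => //.
    by move=> []; exists m => /=.
  move=> _ [m /= mK cm]; have := no (Ordinal mK).
  by move/negbT/asboolPn; apply.
have -> : [set w | label w = g] =
    \bigcap_(i in [set: 'I_L]) (X i : Omega -> R) @^-1` lab (g i) :> set T.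
  apply/seteqP; split => w /=.
    by move=> <- i _ /=; apply/labP; rewrite ffunE.
  by move=> H; apply/ffunP => i; rewrite ffunE; apply/labP; exact: H.
apply: fin_bigcap_measurable => // i _.
by rewrite -[X in measurable X]setTI; exact: mX.
Qed.

Lemma miss_sigma g k i : sxi i (miss g k i).
Proof.
pose T := g_sigma_algebraType (\bigcup_(u in [set u : R | 0 <= u])
  preimage_set_system setT (Y i u) measurable).
change (measurable (miss g k i : set T)).
rewrite /miss; case: obind => [m|]; last exact: measurableT.
apply: measurableC; apply: measurable_hits => // u u0.
exact: (@sigma_of_family_measurable_fun _ _ _ _ (Y i)).
Qed.

Let Ym i u : 0 <= u -> measurable_fun setT (Y i u).
Proof. by []. Qed.

Lemma measurable_label (g : config) : measurable [set w | label w = g].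
Proof.
have mX i : measurable_fun setT (X i : Omega -> R) by [].
have : sX `<=` measurable.
  apply: smallest_sub; first exact: sigma_algebra_measurable.
  by move=> _ [i _ [A mA <-]]; exact: mX.
by move=> /(_ _ (label_sigma g)).
Qed.

Lemma near_weight_le1 u m : 0 <= u -> near_weight u m <= 1.
Proof.
move=> u0; apply: le_trans (near_weight_le 0%N m u0) _.
have mH := measurable_hits h a delta0 (pos m) u0 (@Ym 0%N).
by rewrite -lee_fin fineK ?(fin_num_measure P _ mH)// probability_le1.
Qed.

Lemma measurable_miss g k i : measurable (miss g k i).
Proof.
rewrite /miss; case: obind => [m|]; last exact: measurableT.
by apply: measurableC; apply: measurable_hits => // u; exact: Ym.
Qed.

(** For a fixed label, the misses are independent of the positions and of each other. Node [i]
    misses with probability at most [1 - w i], and the [w i] sum to at least [n0 / 4]: every cell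
    holds at least [n0] nodes, and the weights of the cells sum to at least 1/4. *)
Lemma label_miss_prob (g : config) k : rich g -> (k < N)%N ->
  (P ([set w | label w = g] `&` \bigcap_(i in `I_L) miss g k i)
    <= P [set w | label w = g] * (expR (- (n0%:R / 4)))%:E)%E.
Proof.
move=> /forallP rg kN.
rewrite (mutually_independent_list _ (nodes_indep BN)); last first.
- by move=> i _; exact: miss_sigma.
- exact: label_sigma.
- by move=> [i|]; exact: (@measurableT _ (g_sigma_algebraType _)).
apply: lee_wpmul2l => //.
pose w i := oapp (near_weight (time k) \o val) 0 (g i).
have tks : time k <= s ^+ 2.
  by apply: le_trans Ndelta; rewrite ler_pM2r// ler_nat ltnW.
have w01 i : 0 <= w i <= 1.
  rewrite /w; case: (g i) => [m|] /=; last by rewrite lexx ler01.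
  by rewrite near_weight_le1// /near_weight le_max lexx.
have missE (i : 'I_L) : (P (miss g k i) <= (1 - w i)%:E)%E.
  rewrite /miss valK /= /w; case: (g i) => [m|] /=; last first.
    by rewrite subr0 probability_le1.
  have mH := measurable_hits h a delta0 (pos m) (time_ge0 k) (@Ym i).
  rewrite probability_setC// -(fineK (fin_num_measure P _ mH)) -EFinB lee_fin.
  by rewrite lerD2l lerN2; exact: near_weight_le.
apply: (@le_trans _ _ (\prod_i (1 - w i))%:E).
  rewrite -prodEFin.
  (* Nonnegativity is carried along because multiplying inequalities in [\bar R] requires it. *)
  suff [] : (0 <= \prod_(i < L) P (miss g k i))%E /\
    (\prod_(i < L) P (miss g k i) <= \prod_(i < L) (1 - w i)%:E)%E by [].
  elim/big_ind2: _ => [|x1 x2 y1 y2 [x0 x12] [y0 y12]|i _]; first by split.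
    by split; [exact: mule_ge0|exact: lee_pmul].
  by split => //; exact: missE.
rewrite lee_fin; apply: le_trans (prod_le_expR w01) _.
rewrite ler_expR lerN2.
apply: le_trans (sum_label_ge (f := near_weight (time k) \o val) _ rg).
  by rewrite ler_wpM2l//; exact: near_weight_sum.
by move=> m; rewrite /near_weight /= le_max lexx.
Qed.

(* The index [i] ranges over all nodes, so that the event does not depend on [L]. *)
Definition always_hit : set Omega :=
  \bigcap_(k in `I_N) \bigcup_i \bigcup_(m in `I_K)
    ((X i : Omega -> R) @^-1` cell h M m `&` hits h delta a (Y i) (pos m) (time k)).

Lemma measurable_always_hit : measurable always_hit.
Proof.
apply: bigcap_measurableType => k _; apply: bigcupT_measurable => i.
apply: bigcup_measurable => m _; apply: measurableI.
  have mX : measurable_fun setT (X i : Omega -> R) by [].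
  by rewrite -[X in measurable X]setTI; apply: mX => //; exact: measurable_cell.
by apply: measurable_hits => // u; exact: Ym.
Qed.

(** On the event with label [g], failure of [always_hit] forces all nodes in cells to miss at one
    common grid time. Summed over the [N] grid times, this takes away at most half of the
    probability of the label. *)
Lemma label_always_hit (g : config) : rich g ->
  (P [set w | label w = g]
     <= 2%:E * P ([set w | label w = g] `&` always_hit))%E.
Proof.
move=> rg; have mg := measurable_label g.
have mG := measurable_always_hit.
set C := [set w | label w = g].
pose Z k := C `&` \bigcap_(i in `I_L) miss g k i.
have mZ k : measurable (Z k).
  apply: measurableI => //; apply: bigcap_measurableType => i _.
  exact: measurable_miss.
have mCG : measurable (C `&` always_hit) by exact: measurableI.
have sub : C `<=` (C `&` always_hit) `|` \big[setU/set0]_(k < N) Z k.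
  move=> w Cw; have [?|nG] := pselect (always_hit w); [by left|right].
  have [k kN hk] : exists2 k, (k < N)%N & ~ (\bigcup_i \bigcup_(m in `I_K)
    ((X i : Omega -> R) @^-1` cell h M m
      `&` hits h delta a (Y i) (pos m) (time k))) w.
    apply: contrapT => nk; apply: nG => k /= kN.
    by apply: contrapT => hk; apply: nk; exists k.
  rewrite -bigcup_mkord; exists k => //; split => // i /= iL.
  rewrite /miss insubT /=; case gi : (g _) => [m|] //= hw.
  apply: hk; exists i => //; exists m => //=; split => //=.
  by move: gi; rewrite -Cw ffunE => /eqP; rewrite pick_cell => /asboolP.
have : (P C <= P (C `&` always_hit) + P C * (2^-1)%:E)%E.
  apply: le_trans (measure_mono P mg _ sub) _.
    by apply: measurableU => //; exact: bigsetU_measurable.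
  apply: le_trans (measureU2 _ mCG _) _; first exact: bigsetU_measurable.
  apply: leeD2l; apply: le_trans (Boole_inequality P (fun k _ => mZ k)) _.
  apply: (@le_trans _ _ (\sum_(k < N) P C * (expR (- (n0%:R / 4)))%:E)%E).
    by apply: lee_sum => k _; apply: label_miss_prob.
  rewrite -(fineK (fin_num_measure P _ mg)) -EFinM sumEFin sumr_const card_ord.
  rewrite -EFinM lee_fin -[leLHS]mulr_natl mulrCA ler_wpM2l//.
  exact: fine_ge0.
rewrite -(fineK (fin_num_measure P _ mg)) -(fineK (fin_num_measure P _ mCG)).
by rewrite -!EFinM -EFinD !lee_fin; lra.
Qed.

(** Total probability over the finitely many rich labels. *)
Lemma rich_always_hit :
  (P [set w | rich (label w)] <= 2%:E * P always_hit)%E.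
Proof.
have mG := measurable_always_hit.
have E : [set w | rich (label w)] =
    \bigcup_(g in [set g | rich g]) [set w | label w = g].
  by apply/seteqP; split => w /= => [rw|[g rg /= ->]//]; exists (label w).
have fin : finite_set [set g | rich g] by exact: (@finite_finpred _ _ rich).
rewrite E measure_fin_bigcup//; last 2 first.
- by move=> g1 g2 _ _ [w [/= <- <-]].
- by move=> g _; exact: measurable_label.
apply: (@le_trans _ _ (\sum_(g \in [set g | rich g])
  (2%:E * P ([set w | label w = g] `&` always_hit)))%E).
  by apply: lee_fsum => // g /= rg; exact: label_always_hit.
rewrite -ge0_mule_fsumr//; apply: lee_wpmul2l => //.
rewrite -measure_fin_bigcup//.
- apply: measure_mono => //.
  + apply: fin_bigcup_measurable => // g _.
    by apply: measurableI => //; exact: measurable_label.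
  + by move=> w [g _ []].
- by move=> g1 g2 _ _ [w [[/= <- _] [/= <- _]]].
- by move=> g _; apply: measurableI => //; exact: measurable_label.
Qed.

End covering.

(** * From the grid times to all times up to [t] *)

Section isolation.
Context {R : realType} {d} {Omega : measurableType d} {P : probability Omega R}.
Context {X : nat -> {RV P >-> R}} {xi : nat -> R -> {RV P >-> R}}.

(** The node's distance to the origin is at most [h] for its place in the cell, plus [h] for the hit
    at the last grid time, plus [8 * a] for the motion since then. *)
Lemma always_hit_isol (h delta a r t : R) (M N : nat) (w : Omega) :
  0 < h -> 0 < delta -> 0 < a -> 0 < r -> h + h + 8 * a <= r ->
  t < N%:R * delta ->
  (forall i, {within [set s : R | 0 <= s], continuous (fun s => xi i s w)}) ->
  always_hit (X := X) (xi := xi) h delta a M N w ->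
  (t%:E < T_isol r X xi w)%E.
Proof.
move=> h0 d0 a0 r0 har tN cxi hw.
(* Strictness survives the infimum because all uncovered times are at least [N * delta], a fixed
   amount above [t]. *)
apply: (@lt_le_trans _ _ (N%:R * delta)%:E); first by rewrite lte_fin.
apply: le_ereal_inf_tmp => _ [u [u0 nc] <-]; rewrite lee_fin leNgt.
apply/negP => uN; apply: nc.
pose v := u / delta.
have v0 : 0 <= v by rewrite divr_ge0// ltW.
have /andP[kv vk] := truncn_itv v0.
have uE : u = v * delta by rewrite /v divfK// gt_eqF.
have kN : (Num.truncn v < N)%N.
  by rewrite truncn_lt_nat// /v ltr_pdivrMr.
have [i _ [m mK [/= cm [hm nosc]]]] := hw _ kN.
exists i => //; rewrite closed_ballE// /closed_ball_ /= subr0.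
set k := Num.truncn v in kv vk cm hm nosc.
have u1 : k%:R * delta <= u by rewrite uE ler_pM2r.
have u2 : u < k%:R * delta + delta.
  by rewrite uE -[X in _ + X]mul1r -mulrDl natr1 ltr_pM2r.
have osc := oscillates_control (mulr_ge0 (ler0n _ k) (ltW d0)) d0 (ltW a0)
  (cxi i) nosc u1 u2.
have := cell_dist cm; move: osc; move: hm => /=.
move: (X i w) (xi i u w) (xi i (k%:R * delta) w) (cell_pos h M m) => x b b' c.
rewrite !ler_norml => /andP[? ?] /andP[? ?] /andP[? ?].
by apply/andP; split; lra.
Qed.

End isolation.

(** * Poisson counts in the cells *)

Section poisson.
Context {R : realType} {d} {Omega : measurableType d} {P : probability Omega R}.
Context {lambda : R} {X : nat -> {RV P >-> R}} (PP : poisson_process P lambda X).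

(** The indices of the points in [A] must form one of the countably many finite sets of cardinality
    [k]. *)
Lemma measurable_point_count (A : set R) (k : nat) : measurable A ->
  measurable [set w | point_count X A w = k%:R%:E].
Proof.
move=> mA.
rewrite (_ : [set w | _] = \bigcup_(F in [set F : {fset nat} | #|` F| = k])
    \bigcap_i [set w | A (X i w) <-> i \in F]); last first.
  apply/seteqP; split => w /=; rewrite /point_count /counting.
    case: ifPn => // /asboolP fin [] /eqP; rewrite eqr_nat => /eqP cE.
    exists (fset_set [set i | A (X i w)]) => //= i _ /=.
    by rewrite in_fset_set//; split => [hi|/set_mem]; first exact: mem_set.
  move=> [F /= Fk FE].
  have -> : [set i | A (X i w)] = [set` F].
    by apply/seteqP; split => i /=; apply FE.
  by rewrite asboolT ?set_fsetK ?Fk//; exact: finite_fset.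
rewrite bigcup_mkcond; apply: countable_bigcupT_measurable => // F.
case: ifP => // _; apply: bigcapT_measurable => i.
have mX : measurable [set w | A (X i w)].
  have mX : measurable_fun setT (X i : Omega -> R) by [].
  by rewrite -[X in measurable X]setTI; apply: mX.
case: (boolP (i \in F)) => iF.
  by rewrite (_ : [set w | _] = [set w | A (X i w)])//; apply/seteqP;
    split => w //= -[_]; apply.
rewrite (_ : [set w | _] = ~` [set w | A (X i w)]); first exact: measurableC.
by apply/seteqP; split => w /= => [[h _] /h|h]//; split.
Qed.

Lemma poisson_cells_prob (h : R) (M K n : nat) : 0 < h -> 0 < lambda ->
  P (\bigcap_(m in `I_K) [set w | point_count X (cell h M m) w = n%:R%:E])
  = ((expR (- (lambda * h)) * (lambda * h) ^+ n / n`!%:R) ^+ K)%:E.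
Proof.
move=> h0 l0.
have ind := @poisson_indep _ _ _ _ _ _ PP _ (measurable_cell h M) (trivIset_cell h0).
pose J := [fset (val m) | m in 'I_K]%fset.
have := ind J (fun m => [set w | point_count X (cell h M m) w = n%:R%:E]).
have -> : [set` J] = `I_K.
  apply/seteqP; split => m /=; first by move=> /imfsetP[i _ ->] /=.
  by move=> mK; apply/imfsetP; exists (Ordinal mK).
move=> ->; last first.
  move=> m; exists [set n%:R%:E]; first exact: emeasurable_set1.
  by rewrite setTI.
rewrite big_imfset/=; last by move=> i j _ _ /val_inj.
rewrite big_enum /= (eq_bigr (fun=> (expR (- (lambda * h)) * (lambda * h) ^+ n / n`!%:R)%:E)).
  by rewrite prodEFin prodr_const card_ord.
move=> m _.
have := poisson_count PP n (measurable_cell h M m).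
rewrite lebesgue_measure_cell//= ltry.
by move=> /(_ isT) ->.
Qed.

End poisson.

(** * From the first [L] nodes to the whole process *)

Section limit.
Context {R : realType} {d} {Omega : measurableType d} {P : probability Omega R}.
Context {lambda : R} {X : nat -> {RV P >-> R}} {xi : nat -> R -> {RV P >-> R}}.
Hypothesis BN : brownian_nodes P lambda X xi.

(** In this form [L] enters only as the range of a sum, which makes monotonicity in [L] apparent. *)
Lemma rich_labelE (h : R) (M n L : nat) (w : Omega) : 0 < h ->
  rich n (label (X := X) h M L w) =
  [forall m : 'I_M.*2, (n <= \sum_(i < L) `[< cell h M m (X i w) >])%N].
Proof.
move=> h0; apply: eq_forallb => m; congr (_ <= _)%N.
rewrite -sum1_card big_mkcond /=; apply: eq_bigr => i _.
by rewrite inE ffunE pick_cell//; case: asbool.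
Qed.

Lemma count_sum_ge (D : set nat) (n : nat) :
  counting D = n%:R%:E :> \bar R ->
  exists L0, forall L, (L0 <= L)%N -> (n <= \sum_(i < L) `[< D i >])%N.
Proof.
rewrite /counting; case: ifPn => // /asboolP fin [] /eqP; rewrite eqr_nat => /eqP <-.
(* Beyond the largest index of [D], the sum counts all of [D]. *)
exists (\max_(i <- fset_set D) i).+1 => L LL.
rewrite -(big_mkord xpredT (fun i => `[< D i >] : nat)) /index_iota subn0.
have -> : (\sum_(i <- iota 0 L) `[< D i >] = count (fun i => `[< D i >]) (iota 0 L))%N.
  by rewrite -sum1_count [RHS]big_mkcond; apply: eq_bigr => i _; case: asbool.
rewrite -size_filter; apply: uniq_leq_size; first exact: fset_uniq.
move=> i iD; rewrite mem_filter mem_iota /= add0n.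
rewrite (leq_ltn_trans _ LL) ?andbT; last exact: leq_bigmax_seq.
by apply/asboolP; move: iD; rewrite in_fset_set// => /set_mem.
Qed.

Lemma cells_rich (h : R) (M n : nat) (w : Omega) : 0 < h ->
  (forall m, (m < M.*2)%N -> point_count X (cell h M m) w = n%:R%:E) ->
  exists L, rich n (label (X := X) h M L w).
Proof.
move=> h0 cnt.
have H (m : 'I_M.*2) := count_sum_ge (cnt m (ltn_ord m)).
pose L0 m := sval (cid (H m)).
exists (\max_m L0 m); rewrite rich_labelE//; apply/forallP => m.
by apply: (svalP (cid (H m))); exact: leq_bigmax.
Qed.

(** The events that the first [L] nodes fill the cells increase with [L], and their union contains
    the event of exactly [n0] points in each cell. Since [always_hit] does not involve [L], the
    bound survives the limit. *)
Lemma always_hit_prob (h delta a y s : R) (M n0 N : nat) :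
  0 < lambda -> 0 < h -> 0 < delta -> 0 < a -> 0 < s ->
  6 <= y -> y = a ^+ 2 / (2 * delta) ->
  2 * s < M%:R * h -> M.*2%:R * (4 * expR (- y)) <= 4^-1 ->
  N%:R * delta <= s ^+ 2 ->
  N%:R * expR (- (n0%:R / 4)) <= 2^-1 :> R ->
  (((expR (- (lambda * h)) * (lambda * h) ^+ n0 / n0`!%:R) ^+ M.*2)%:E
    <= 2 * P (always_hit (X := X) (xi := xi) h delta a M N))%E.
Proof.
move=> l0 h0 d0 a0 s0 y6 yE sM yM Nd n0N.
have PP := nodes_poisson BN.
rewrite -(poisson_cells_prob PP M M.*2 n0 h0 l0).
pose F L := [set w | rich n0 (label (X := X) h M L w)].
have mF L : measurable (F L).
  rewrite (_ : F L = \bigcup_(g in [set g | rich n0 g]) [set w | label (X := X) h M L w = g]).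
    by apply: fin_bigcup_measurable => // g _; exact: measurable_label.
  rewrite /F; apply/seteqP; split => w /= => [rw|[g rg /= ->]//].
  by exists (label (X := X) h M L w).
have ndF : {homo F : n m / (n <= m)%N >-> (n <= m)%O}.
  apply/nondecreasing_seqP => L; rewrite subsetEset => w; rewrite /F /= !rich_labelE//.
  move=> /forallP rw; apply/forallP => m; apply: leq_trans (rw m) _.
  by rewrite big_ord_recr /= leq_addr.
have mUF : measurable (\bigcup_L F L) by exact: bigcupT_measurable.
apply: (@le_trans _ _ (P (\bigcup_L F L))).
  apply: measure_mono => //.
    apply: bigcap_measurableType => m _.
    by apply: measurable_point_count; exact: measurable_cell.
  by move=> w hw; have [L rw] := cells_rich h0 hw; exists L.
have cvgF := nondecreasing_cvg_mu (mu := P) mF mUF ndF.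
rewrite -(cvg_lim _ cvgF)//; apply: lime_le; first by apply/cvg_ex; eexists; exact: cvgF.
by apply: nearW => L; exact: (rich_always_hit BN h0 d0 a0 s0 y6 yE sM yM Nd n0N).
Qed.

(** Removing a null set that contains all outcomes with a discontinuous path leaves a measurable
    subset of the target event, without changing the probability. *)
Lemma isol_inner_prob_ge (h delta a r t : R) (M N : nat) :
  0 < h -> 0 < delta -> 0 < a -> 0 < r -> h + h + 8 * a <= r ->
  t < N%:R * delta ->
  (P (always_hit (X := X) (xi := xi) h delta a M N)
    <= inner_prob P [set w | t%:E < T_isol r X xi w])%E.
Proof.
move=> h0 d0 a0 r0 har tN.
have /choice[Z HZ] i := brownian_cont (nodes_brownian BN i).
have mZ i : measurable (Z i) by have [] := HZ i.
pose U := \bigcup_i Z i.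
have mU : measurable U by exact: bigcupT_measurable.
have U0 : P U = 0.
  apply/eqP; rewrite eq_le measure_ge0 andbT.
  apply: le_trans (measure_sigma_subadditive P mZ mU _) _; first by [].
  by rewrite eseries0// => i _ _; have [] := HZ i.
set A := always_hit _ _ _ _ _.
have mA : measurable A by exact: measurable_always_hit.
have -> : P A = P (A `\` U).
  apply: ae_measure_eq => //; first exact: measurableD.
  exists U; split => // w /= nAU; apply: contrapT => nU; apply: nAU.
  by split => // -[].
apply: ereal_sup_ubound; exists (A `\` U) => //; split; first exact: measurableD.
move=> w [Aw nUw]; apply: (always_hit_isol h0 d0 a0 r0 har tN _ Aw) => i.
apply: contrapT => nc; apply: nUw; exists i => //.
by have [_ _] := HZ i; apply.
Qed.

End limit.

(** * Choice of the parameters and asymptotics *)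

Lemma fact_le_expn (n : nat) : (n`! <= n ^ n)%N.
Proof.
elim: n => // -[//|n] ih; rewrite factS expnS leq_mul2l /=.
by apply: leq_trans ih _; rewrite leq_exp2r.
Qed.

Section asymptotics.
Context {R : realType}.

(** Meant for [x = ln t] and [z = ln (ln t)]. The three summands of the constant absorb [mu],
    [n * ln mu] and, bounding the factorial by [n ^ n], [n * ln n]; each is at most its coefficient
    times [x * z]. *)
Lemma poisson_weight_ge (mu x z : R) (n : nat) :
  0 < mu -> (0 < n)%N -> 1 <= x -> 1 <= z -> n%:R <= 13 * x -> ln n%:R <= 2 * z ->
  expR (- ((mu + 13 * `|ln mu| + 26) * (x * z)))
    <= expR (- mu) * mu ^+ n / n`!%:R.
Proof.
move=> mu0 n0 x1 z1 nx nz.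
have n0R : 0 < n%:R :> R by rewrite ltr0n.
have f0 : 0 < n`!%:R :> R by rewrite ltr0n fact_gt0.
have facle : n`!%:R <= expR (n%:R * ln n%:R) :> R.
  rewrite expRM_natl lnK ?posrE// -natrX ler_nat.
  exact: fact_le_expn.
have muE : mu ^+ n = expR (n%:R * ln mu) by rewrite expRM_natl lnK.
rewrite ler_pdivlMr// muE -expRD.
apply: (@le_trans _ _ (expR (- ((mu + 13 * `|ln mu| + 26) * (x * z)))
  * expR (n%:R * ln n%:R))); first by rewrite ler_pM2l ?expR_gt0.
rewrite -expRD ler_expR.
have xz1 : 1 <= x * z by rewrite mulr_ege1.
have xz2 : x <= x * z by rewrite ler_peMr// (le_trans _ x1).
have h1 : mu <= mu * (x * z) by rewrite ler_peMr// ltW.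
have h2 : - (n%:R * ln mu) <= 13 * `|ln mu| * (x * z).
  apply: (@le_trans _ _ (n%:R * `|ln mu|)).
    by rewrite -mulrN ler_pM2l// -normrN ler_norm.
  rewrite mulrAC ler_wpM2r// (le_trans nx)// ler_pM2l//.
have h3 : n%:R * ln n%:R <= 26 * (x * z).
  rewrite (_ : 26 * (x * z) = (13 * x) * (2 * z)); last by ring.
  by apply: ler_pM => //; rewrite ?ln_ge0// ler1n.
rewrite !mulrDl; lra.
Qed.

Lemma expR2_ge : 2 <= expR 1 :> R.
Proof. by rewrite (le_trans _ (expR_ge1Dx _)). Qed.

End asymptotics.

Theorem theorem1p2 (R : realType) (lambda r : R)
    (lambda_gt0 : 0 < lambda) (r_gt0 : 0 < r) :
  exists t0 c : R, 0 < t0 /\ 0 < c /\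
    forall (d : measure_display) (Omega : measurableType d)
      (P : probability Omega R)
      (X : nat -> {RV P >-> R}) (xi : nat -> R -> {RV P >-> R}),
      brownian_nodes P lambda X xi ->
      forall t : R, t0 <= t ->
        ((expR (- (c * Num.sqrt t * ln t * ln (ln t))))%:E
          <= inner_prob P [set w | t%:E < T_isol r X xi w])%E.
Proof.
(* The choice gives [2 * h + 8 * a = r] exactly; [B] is such that [B * h > 2]. *)
pose h := r / 3; pose a := r / 24; pose mu := lambda * h.
pose B := (Num.truncn (2 / h)).+1; pose D := mu + 13 * `|ln mu| + 26.
have h0 : 0 < h by rewrite divr_gt0.
have a0 : 0 < a by rewrite divr_gt0.
have mu0 : 0 < mu by rewrite mulr_gt0.
have B1 : 1 <= B%:R :> R by rewrite ler1n.
have Bh : 2 < B%:R * h by rewrite -ltr_pdivrMr// truncnS_gt.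
have a20 : 0 < a ^+ 2 by rewrite exprn_gt0.
have D0 : 0 < D by rewrite /D; have : 0 <= `|ln mu| by []; lra.
(* The summands give in turn [1 <= ln (ln t)], then [13 * ln t <= (ln t) ^+ 2], then
   [32 * t ^+ 2 <= t ^+ 3], and finally [sqrt t >= 64 * B / a ^+ 2], so that [y] dominates the
   number of cells. *)
pose t0 : R := expR (expR 1) + expR 13 + 32 + (64 * B%:R / a ^+ 2) ^+ 2.
(* There are at most [4 * B * sqrt t] cells, each costing [D * ln t * ln (ln t)] in the exponent;
   the extra 1 pays for the factor 2 in front of the probability of [always_hit]. *)
exists t0, (4 * B%:R * D + 1).
have ee0 : 0 < expR (expR 1) :> R by exact: expR_gt0.
have e130 : 0 < expR 13 :> R by exact: expR_gt0.
have sq0 : 0 <= (64 * B%:R / a ^+ 2) ^+ 2 by exact: sqr_ge0.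
split; first by rewrite /t0; lra.
split; first by rewrite ltr_wpDl// !mulr_ge0// ltW.
move=> d Omega P X xi BN t tt0.
have t32 : 32 <= t by move: tt0; rewrite /t0; lra.
have t_gt0 : 0 < t by lra.
pose x := ln t; pose z := ln x.
have x13 : 13 <= x.
  by rewrite -(expRK 13) ler_ln ?posrE// ; move: tt0; rewrite /t0; lra.
have x0 : 0 < x by lra.
have z1 : 1 <= z.
  rewrite -(expRK 1) ler_ln ?posrE ?expR_gt0// -[leLHS]expRK.
  by rewrite ler_ln ?posrE// ; move: tt0; rewrite /t0; lra.
pose sq := Num.sqrt t.
have sqB : 64 * B%:R / a ^+ 2 <= sq.
  rewrite -(ger0_norm (_ : 0 <= 64 * B%:R / a ^+ 2)); last first.
    by rewrite divr_ge0 ?mulr_ge0// ltW.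
  by rewrite -sqrtr_sqr ler_wsqrtr//; move: tt0; rewrite /t0; lra.
have sq1 : 1 <= sq by rewrite -sqrtr1 ler_wsqrtr//; lra.
have sq2 : sq ^+ 2 = t by rewrite sqr_sqrtr// ltW.
(* An integer above [sqrt t] and at most twice as large, so that [M] and [N] can be natural
   numbers. *)
pose sigma := (Num.truncn sq).+1; pose s : R := sigma%:R.
have ssq : sq < s by exact: truncnS_gt.
have s2sq : s <= 2 * sq.
  have /andP[] := truncn_itv (le_trans ler01 sq1); rewrite /s /sigma -natr1; lra.
have s0 : 0 < s by lra.
(* The mesh [1 / s ^+ 2] makes the oscillation exponent [y] of order [s ^+ 2]; [sigma ^ 4] steps
   then reach time [s ^+ 2 > t]. *)
pose delta := (s ^+ 2)^-1; pose N := (sigma ^ 4)%N; pose M := (B * sigma)%N.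
have d0 : 0 < delta by rewrite invr_gt0 exprn_gt0.
have Nd : N%:R * delta = s ^+ 2.
  by rewrite /N /delta natrX -/s; field; rewrite gt_eqF.
have tN : t < N%:R * delta.
  by rewrite Nd -sq2 ltr_pXn2r// nnegrE; lra.
pose y := a ^+ 2 / (2 * delta).
have yE : y = a ^+ 2 * s ^+ 2 / 2.
  by rewrite /y /delta; field; rewrite gt_eqF.
have as64 : 64 * B%:R <= a ^+ 2 * s.
  by rewrite [leRHS]mulrC -ler_pdivrMr//; lra.
have y32 : 32 * B%:R * s <= y.
  rewrite yE (_ : _ / 2 = a ^+ 2 * s * s / 2); last by ring.
  by rewrite ler_pdivlMr// mulrAC ler_pM2r//; lra.
have Bs1 : 1 <= B%:R * s by rewrite mulr_ege1//; lra.
have y6 : 6 <= y by apply: le_trans y32; lra.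
have sM : 2 * s < M%:R * h.
  by rewrite /M natrM -/s mulrAC ltr_pM2r.
have yM : M.*2%:R * (4 * expR (- y)) <= 4^-1.
  rewrite -muln2 /M !natrM -/s expRN mulrA ler_pdivrMr ?expR_gt0//.
  have := expR_ge1Dx y; lra.
(* With [n0 > 12 * ln t], [expR (- (n0 / 4))] is at most [t ^- 3], which beats the at most
   [16 * t ^+ 2] grid times. *)
pose n0 := (Num.truncn (12 * x)).+1.
have n0x : 12 * x < n0%:R by exact: truncnS_gt.
have n0x' : n0%:R <= 13 * x.
  have /andP[] := truncn_itv (mulr_ge0 (ler0n _ 12) (ltW x0)).
  by rewrite /n0 -natr1; lra.
have n0N : N%:R * expR (- (n0%:R / 4)) <= 2^-1 :> R.
  rewrite expRN ler_pdivrMr ?expR_gt0// ler_pdivlMl//.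
  apply: (@le_trans _ _ (expR (3 * x))); last by rewrite ler_expR; lra.
  rewrite expRM_natl lnK ?posrE//.
  apply: (@le_trans _ _ (32 * t ^+ 2)); last first.
    by rewrite [leRHS]exprS ler_pM2r// exprn_gt0.
  rewrite /N natrX -/s -sq2 -exprM.
  have : s ^+ 4 <= (2 * sq) ^+ 4 by rewrite lerXn2r ?nnegrE// mulr_ge0// (le_trans ler01 sq1).
  rewrite exprMn; lra.
have lnn0 : ln n0%:R <= 2 * z.
  rewrite mulr_natl -lnXn// ler_ln ?posrE ?ltr0n// ?exprn_gt0//.
  by apply: (le_trans n0x'); rewrite expr2 ler_pM2r.
have har : h + h + 8 * a <= r by rewrite /h /a; lra.
apply: (le_trans _ (isol_inner_prob_ge BN M h0 d0 a0 r_gt0 har tN)).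
have := always_hit_prob BN lambda_gt0 h0 d0 a0 s0 y6 erefl sM yM _ n0N.
rewrite Nd => /(_ (lexx _)).
have mA := measurable_always_hit (X := X) (xi := xi) h a M N d0.
rewrite -(fineK (fin_num_measure P _ mA)) -EFinM !lee_fin => hP.
rewrite -(ler_pM2l (_ : 0 < 2 :> R))//; apply: le_trans hP.
have x1 : 1 <= x by lra.
have q := poisson_weight_ge mu0 (ltn0Sn _ : (0 < n0)%N) x1 z1 n0x' lnn0.
apply: (@le_trans _ _ (expR (- (D * (x * z))) ^+ M.*2)); last first.
  by rewrite lerXn2r ?nnegrE ?expR_ge0// (le_trans _ q)// expR_ge0.
rewrite -expRM_natl.
apply: (@le_trans _ _ (expR 1 * expR (- ((4 * B%:R * D + 1) * sq * x * z)))).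
  by rewrite ler_pM2r ?expR_gt0// expR2_ge.
rewrite -expRD ler_expR.
have xz1 : 1 <= x * z by rewrite mulr_ege1.
have sxz : 1 <= sq * (x * z) by rewrite mulr_ege1.
have MK : M.*2%:R <= 4 * B%:R * sq.
  rewrite -muln2 /M !natrM -/s -mulrA (_ : 4 * _ * _ = B%:R * (4 * sq)); last by ring.
  by rewrite (ler_pM2l (lt_le_trans ltr01 B1)); move: s2sq; clear; lra.
have : M.*2%:R * (D * (x * z)) <= 4 * B%:R * sq * (D * (x * z)).
  by rewrite ler_pM2r// mulr_gt0// (lt_le_trans ltr01 xz1).
lra.
Qed.
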